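(* Let $n\ge 1$ be an integer and let $\mathcal{Q}_U=\{\mathrm{I},\mathrm{Z}\}\otimes\{\mathrm{I}\}^{\otimes n-1}$. For $P\in\{\mathrm{X},\mathrm{Y},\mathrm{Z}\}$ let $\mathcal{E}_{P\otimes \mathrm{I}^{\otimes n-1}}(\cdot)=(P\otimes \mathrm{I}^{\otimes n-1})\cdot(P\otimes \mathrm{I}^{\otimes n-1})$ be the corresponding single-qubit Pauli channel, and let $$\mathscr{T}_{\mathcal{Q}_U}(\mathcal{E}_{P\otimes \mathrm{I}^{\otimes n-1}})=\mathbb{E}_{D\in\mathcal{G}_{n,\mathcal{Q}_U}}\left[\mathcal{D}^\dagger\circ\mathcal{E}_{P\otimes \mathrm{I}^{\otimes n-1}}\circ\mathcal{D}\right]$$ be its symmetric Clifford twirling. Then for $P=\mathrm{X}$ and for $P=\mathrm{Y}$, $$\mathscr{T}_{\mathcal{Q}_U}(\mathcal{E}_{P\otimes \mathrm{I}^{\otimes n-1}})=\mathbb{E}_{Q_1\in\{\mathrm{X},\mathrm{Y}\},\;Q_2\in\mathcal{P}_{n-1}}\left[\mathcal{E}_{Q_1\otimes Q_2}\right],$$ while for $P=\mathrm{Z}$, $$\mathscr{T}_{\mathcal{Q}_U}(\mathcal{E}_{\mathrm{Z}\otimes \mathrm{I}^{\otimes n-1}})=\mathcal{E}_{\mathrm{Z}\otimes \mathrm{I}^{\otimes n-1}}.$$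
   Context: $\mathrm{I},\mathrm{X},\mathrm{Y},\mathrm{Z}$ are the single-qubit identity and Pauli matrices, and $\mathcal{P}_m=\{\mathrm{I},\mathrm{X},\mathrm{Y},\mathrm{Z}\}^{\otimes m}$ is the set of $4^m$ $m$-qubit Pauli operators (without phases). $\mathcal{G}_n$ is the $n$-qubit Clifford group (unitaries on $(\mathbb{C}^2)^{\otimes n}$ that map Pauli operators to Pauli operators up to phase under conjugation), elements being considered up to global phase, so that it is finite. The $\mathcal{Q}_U$-symmetric Clifford group is $\mathcal{G}_{n,\mathcal{Q}_U}=\{C\in\mathcal{G}_n \mid [C,P]=0 \text{ for all } P\in\mathcal{Q}_U\}$. For a unitary $D$, $\mathcal{D}(\cdot)=D\cdot D^\dagger$ and $\mathcal{D}^\dagger(\cdot)=D^\dagger\cdot D$. For a Pauli operator $Q$, $\mathcal{E}_Q(\cdot)=Q\cdot Q$. $\mathbb{E}$ denotes the uniform average over the indicated finite set. (The group $\mathcal{Q}_U$ here is the one associated with the Pauli-Z rotation $U=e^{i\theta \mathrm{Z}\otimes \mathrm{I}^{\otimes n-1}}$ on the first qubit.) *)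

(* Defs.v *)
From HB Require Import structures.
From mathcomp Require Import all_boot all_order all_algebra.
From mathcomp Require Import generic_quotient finmap spectral sesquilinear.
From mathcomp Require Import boolp classical_sets functions cardinality fsbigop.
From mathcomp Require Import reals complex mxtens.

Set Implicit Arguments.
Unset Strict Implicit.
Unset Printing Implicit Defensive.

Import Order.TTheory GRing.Theory Num.Theory.
Local Open Scope quotient_scope.
Local Open Scope classical_set_scope.
Local Open Scope ring_scope.
Local Open Scope sesquilinear_scope.

(* [qdim n] is [2 ^ n] (lemma [qdimE]), in a form that makes
   [qdim n.+1] convertible to [2 * qdim n]: Kronecker products with a first
   qubit then typecheck without casts. *)
Fixpoint qdim (n : nat) : nat := if n is n'.+1 then (2 * qdim n')%N else 1%N.

Lemma qdimE n : qdim n = (2 ^ n)%N.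
Proof. by elim: n => //= n ->; rewrite expnS. Qed.

Section SymmetricTwirling.
Variable C : numClosedFieldType.

Definition mx2 (a b c d : C) : 'M[C]_2 :=
  \matrix_(i, j) if i == 0 then (if j == 0 then a else b)
                 else (if j == 0 then c else d).

Definition pauliI : 'M[C]_2 := 1%:M.
Definition pauliX : 'M[C]_2 := mx2 0 1 1 0.
Definition pauliY : 'M[C]_2 := mx2 0 (- 'i) 'i 0.
Definition pauliZ : 'M[C]_2 := mx2 1 0 0 (- 1).

(* The empty tensor product is the 1 x 1 identity. *)
Fixpoint paulis (n : nat) : set 'M[C]_(qdim n) :=
  if n is n'.+1 return set 'M[C]_(qdim n) then
    [set P *t Q | P in [set pauliI; pauliX; pauliY; pauliZ] & Q in @paulis n']
  else [set 1%:M].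
Arguments paulis : clear implicits.

Definition phase_equiv (d : nat) : rel 'M[C]_d :=
  fun A B => `[< exists2 z : C, `|z| = 1 & A = z *: B >].

Lemma phase_equiv_refl d : reflexive (@phase_equiv d).
Proof. by move=> A; apply/asboolP; exists 1; rewrite ?normr1 ?scale1r. Qed.

Lemma phase_equiv_sym d : symmetric (@phase_equiv d).
Proof.
suff sub A B : @phase_equiv d A B -> phase_equiv B A.
  by move=> A B; apply/idP/idP; exact: sub.
move=> /asboolP[z z1 ->]; apply/asboolP; exists z^-1.
  by rewrite normfV z1 invr1.
by rewrite scalerA mulVf ?scale1r // -normr_eq0 z1 oner_neq0.
Qed.

Lemma phase_equiv_trans d : transitive (@phase_equiv d).
Proof.
move=> B A D /asboolP[y y1 ->] /asboolP[z z1 ->]; apply/asboolP.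
by exists (y * z); rewrite ?normrM ?y1 ?z1 ?mulr1 // scalerA.
Qed.

Canonical phase_equiv_rel d := EquivRel (@phase_equiv d)
  (@phase_equiv_refl d) (@phase_equiv_sym d) (@phase_equiv_trans d).

Local Notation mod_phase d := {eq_quot (@phase_equiv d)} (only parsing).

Definition clifford_mx (n : nat) : set 'M[C]_(qdim n) :=
  [set U | U \is unitarymx /\
     forall P, paulis n P ->
       exists2 Q, paulis n Q & phase_equiv (U *m P *m U^t*) Q].
Arguments clifford_mx : clear implicits.

Definition sym_clifford_mx (n : nat) (S : set 'M[C]_(qdim n)) :
    set 'M[C]_(qdim n) :=
  [set U | clifford_mx n U /\ forall P, S P -> comm_mx U P].

Definition sym_clifford (n : nat) (S : set 'M[C]_(qdim n)) :
    set (mod_phase (qdim n)) :=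
  \pi_(mod_phase (qdim n)) @` sym_clifford_mx S.

(* Uniform average over a finite nonempty set [A]; the value is 0 when [A] is
   infinite, since [fset_set] is then empty. *)
Definition average (T : choiceType) (V : lmodType C) (A : set T)
    (F : T -> V) : V :=
  (#|` fset_set A|%:R)^-1 *: \sum_(t \in A) F t.

Definition superop (d : nat) := 'M[C]_d -> 'M[C]_d.

Definition chan (d : nat) (U : 'M[C]_d) : superop d :=
  fun rho => U *m rho *m U^t*.

Definition adj_chan (d : nat) (U : 'M[C]_d) : superop d :=
  fun rho => U^t* *m rho *m U.

Definition pauli_chan (d : nat) (Q : 'M[C]_d) : superop d :=
  fun rho => Q *m rho *m Q.

Lemma phase_conj (z : C) : `|z| = 1 -> z * z^* = 1.
Proof. by move=> z1; rewrite -normCK z1 expr1n. Qed.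

Lemma adjZ d (z : C) (U : 'M[C]_d) : (z *: U)^t* = z^* *: U^t*.
Proof. by apply/matrixP => i j; rewrite !mxE rmorphM. Qed.

Lemma chan_phase d (U V : 'M[C]_d) : phase_equiv U V -> chan U = chan V.
Proof.
move=> /asboolP[z z1 ->]; apply/funext => rho; rewrite /chan.
by rewrite adjZ -!scalemxAl -scalemxAr scalerA phase_conj ?scale1r.
Qed.

Lemma adj_chan_phase d (U V : 'M[C]_d) :
  phase_equiv U V -> adj_chan U = adj_chan V.
Proof.
move=> /asboolP[z z1 ->]; apply/funext => rho; rewrite /adj_chan.
by rewrite adjZ -!scalemxAl -scalemxAr scalerA mulrC phase_conj
  ?scale1r.
Qed.

(* By [chan_phase] and [adj_chan_phase], the summand does not depend on the
   unitary that [repr] picks in the phase class [D]. *)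
Definition sym_twirl (n : nat) (S : set 'M[C]_(qdim n))
    (E : superop (qdim n)) : superop (qdim n) :=
  average (sym_clifford S)
    (fun D => adj_chan (repr D) \o E \o chan (repr D) : superop (qdim n)).

Definition on_first (n : nat) (P : 'M[C]_2) : 'M[C]_(qdim n.+1) :=
  P *t (1%:M : 'M[C]_(qdim n)).

Definition QU (n : nat) : set 'M[C]_(qdim n.+1) :=
  [set on_first n P | P in [set pauliI; pauliZ]].
Arguments QU : clear implicits.

End SymmetricTwirling.

Arguments pauliI {C}.
Arguments pauliX {C}.
Arguments pauliY {C}.
Arguments pauliZ {C}.
Arguments paulis {C} n.
Arguments on_first {C} n P.
Arguments clifford_mx {C} n.
Arguments QU {C} n.

(* Main.v *)
(* Write Zf for Z on the first qubit and T for the twirl. Reindexing the group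
   average shows T(E_P) = T(E_Q) as soon as some symmetric Clifford V satisfies
   V P V^* = Q up to phase. The rotation V = exp(i pi/4 Z (x) Q), which commutes
   with Zf, exchanges X (x) I with Y (x) Q and Y (x) I with X (x) Q, so T takes
   one value on all E_(Q1 (x) Q2) with Q1 in {X, Y}, namely T(M) for their mean
   M. The depolarizing identity for the sum of P rho P over all Paulis P shows
   that M rho is proportional to tr(rho) - tr(Zf rho) Zf, which only involves
   Zf; hence conjugation by the group fixes M and T(M) = M. The same identity
   shows that a matrix commuting with all Paulis is scalar, so a Clifford is
   determined up to phase by the signed permutation it induces on Paulis, and
   the group is finite. *)
Require Import Defs.
From mathcomp Require Import all_boot all_order all_algebra.
From mathcomp Require Import generic_quotient finmap spectral sesquilinear ring.
From mathcomp Require Import boolp classical_sets functions cardinality fsbigop.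
From mathcomp Require Import reals complex mxtens.

Set Implicit Arguments.
Unset Strict Implicit.
Unset Printing Implicit Defensive.

Import Order.TTheory GRing.Theory Num.Theory.
Local Open Scope quotient_scope.
Local Open Scope classical_set_scope.
Local Open Scope ring_scope.
Local Open Scope sesquilinear_scope.

(* A pair of booleans labels a single-qubit Pauli: the first one tells whether
   it anticommutes with Z, and multiplication is exclusive or, up to phase. *)
Fixpoint pidx (n : nat) : finType :=
  if n is n'.+1 then ((bool * bool) * pidx n')%type : finType else unit.

(** * Labelled Pauli matrices: products, orthogonality and completeness *)

Section Paulis.
Variable C : numClosedFieldType.
Implicit Types a b c d z : C.

Lemma mx2_mul a b c d a' b' c' d' :
  mx2 a b c d *m mx2 a' b' c' d' =
  mx2 (a * a' + b * c') (a * b' + b * d') (c * a' + d * c') (c * b' + d * d').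
Proof.
by apply/matrixP => i j; rewrite !mxE !big_ord_recl big_ord0 !mxE /= addr0;
  case: ifP; case: ifP.
Qed.

Lemma mx2_scale z a b c d :
  z *: mx2 a b c d = mx2 (z * a) (z * b) (z * c) (z * d).
Proof. by apply/matrixP => i j; rewrite !mxE; do 2!case: (_ == 0). Qed.

Lemma mx2_adj a b c d : (mx2 a b c d)^t* = mx2 a^* c^* b^* d^*.
Proof. by apply/matrixP => i j; rewrite !mxE; do 2!case: (_ == 0). Qed.

Lemma mx2_tr a b c d : \tr (mx2 a b c d) = a + d.
Proof. by rewrite /mxtrace !big_ord_recl big_ord0 !mxE /= addr0. Qed.

Lemma mx2_1 : 1%:M = mx2 1 0 0 1 :> 'M[C]_2.
Proof. by apply/matrixP => -[[|[|?]] ?] [[|[|?]] ?] //; rewrite !mxE. Qed.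

Definition pauli1 (p : bool * bool) : 'M[C]_2 :=
  match p with
  | (false, false) => pauliI
  | (true, false) => pauliX
  | (true, true) => pauliY
  | (false, true) => pauliZ
  end.

Fixpoint pauli (n : nat) : pidx n -> 'M[C]_(qdim n) :=
  if n is n'.+1 return pidx n -> 'M[C]_(qdim n)
  then fun i => pauli1 i.1 *t pauli i.2 else fun=> 1%:M.

Lemma imaginary_sqr : 'i * 'i = -1 :> C. Proof. by rewrite -expr2 sqrCi. Qed.

Lemma pauli1_adj p : (pauli1 p)^t* = pauli1 p.
Proof.
by case: p => [[] []]; rewrite /= /pauliI ?mx2_1 mx2_adj
  ?(rmorph0, rmorph1, rmorphN1, rmorphN) /= ?conjCi ?opprK.
Qed.

Lemma pauli1_sqr p : pauli1 p *m pauli1 p = 1%:M.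
Proof.
case: p => [[] []]; rewrite /= /pauliI ?mul1mx // mx2_mul mx2_1;
congr mx2; rewrite ?(mulNr, mulrN, imaginary_sqr); ring.
Qed.

Lemma pauli1_mul p q : exists2 z : C, `|z| = 1 &
  pauli1 p *m pauli1 q = z *: pauli1 (p.1 (+) q.1, p.2 (+) q.2).
Proof.
have ni : `|- 'i : C| = 1 by rewrite normrN normCi.
case: p q => [[] []] [[] []] /=; rewrite /pauliI ?mul1mx ?mulmx1;
  try (by exists 1; rewrite ?normr1 ?scale1r);
  rewrite !mx2_mul ?mx2_1.
all: try (exists 1; [by rewrite normr1|rewrite scale1r; congr mx2;
       rewrite ?(mulNr, mulrN, imaginary_sqr); ring]).
all: try (exists 'i; [by rewrite normCi|rewrite mx2_scale; congr mx2;
       rewrite ?(mulNr, mulrN, imaginary_sqr); ring]).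
all: try (exists (- 'i); [by []|rewrite mx2_scale; congr mx2;
       rewrite ?(mulNr, mulrN, imaginary_sqr); ring]).
Qed.

Lemma pauli1_ortho p q : \tr (pauli1 p *m pauli1 q) = (2 * (p == q))%:R.
Proof.
case: p q => [[] []] [[] []] /=; rewrite /pauliI ?mx2_1 mx2_mul mx2_tr
  ?(mulNr, mulrN, imaginary_sqr) /= ?muln0 ?muln1; ring.
Qed.

(** Entrywise form of a known identity: the sum of P (x) P over the four Paulis is twice the swap of
    two qubits. *)
Lemma pauli1_complete i j k l :
  \sum_p pauli1 p i j * pauli1 p k l = (2 * ((i == l) && (j == k)))%:R.
Proof.
transitivity (\sum_(x : bool) \sum_(y : bool)
    pauli1 (x, y) i j * pauli1 (x, y) k l).
  by rewrite pair_bigA; apply: eq_bigr => -[].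
rewrite !big_bool /= /pauliI ?mx2_1.
case: i => [[|[|?]] ?] //; case: j => [[|[|?]] ?] //; case: k => [[|[|?]] ?] //;
case: l => [[|[|?]] ?] //; rewrite !mxE /=
  ?(mulNr, mulrN, imaginary_sqr) /=; ring.
Qed.

Lemma pauli_adj n (i : pidx n) : (pauli i)^t* = pauli i.
Proof.
elim: n i => [|n IH] i /=; first by rewrite trmx1 map_mx1.
by rewrite trmx_tens map_mxT /= pauli1_adj IH.
Qed.

Lemma tens1mx1 m n : (1%:M : 'M[C]_m) *t (1%:M : 'M[C]_n) = 1%:M.
Proof.
apply/matrixP => i j.
case: (mxtens_indexP i) => i0 i1; case: (mxtens_indexP j) => j0 j1.
rewrite tensmxE !mxE (can_eq (@mxtens_indexK m n)) xpair_eqE.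
by case: (_ == _); case: (_ == _); rewrite ?(mulr0, mul0r, mulr1).
Qed.

Lemma tensmxZl m n p q z (A : 'M[C]_(m, n)) (B : 'M[C]_(p, q)) :
  (z *: A) *t B = z *: (A *t B).
Proof. by apply/matrixP => i j; rewrite !mxE mulrA. Qed.

Lemma tensmxZr m n p q z (A : 'M[C]_(m, n)) (B : 'M[C]_(p, q)) :
  A *t (z *: B) = z *: (A *t B).
Proof. by apply/matrixP => i j; rewrite !mxE mulrCA. Qed.

Lemma mxtrace_tens m n (A : 'M[C]_m) (B : 'M[C]_n) :
  \tr (A *t B) = \tr A * \tr B.
Proof.
by rewrite /mxtrace mulr_sum; apply: eq_bigr => i _; rewrite mxE.
Qed.

Lemma pauli_sqr n (i : pidx n) : pauli i *m pauli i = 1%:M.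
Proof.
elim: n i => [|n IH] i /=; first by rewrite mul1mx.
by rewrite tensmx_mul pauli1_sqr IH tens1mx1.
Qed.

Lemma pauli_mul n (i j : pidx n) : exists k, exists2 z : C, `|z| = 1 &
  pauli i *m pauli j = z *: pauli k.
Proof.
elim: n i j => [|n IH] i j /=.
  by exists tt, 1; rewrite ?normr1 // mul1mx scale1r.
have [k [z z1 e]] := IH i.2 j.2; have [w w1 f] := pauli1_mul i.1 j.1.
exists ((i.1.1 (+) j.1.1, i.1.2 (+) j.1.2), k), (w * z) => /=.
  by rewrite normrM z1 w1 mulr1.
by rewrite tensmx_mul e f tensmxZl tensmxZr scalerA.
Qed.

Lemma pauli_ortho n (i j : pidx n) :
  \tr (pauli i *m pauli j) = (2 ^ n * (i == j))%:R.
Proof.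
elim: n i j => [|n IH] i j /=.
  by case: i j => [] []; rewrite mul1mx mxtrace1.
rewrite tensmx_mul mxtrace_tens pauli1_ortho IH -natrM.
case: i j => [i1 i2] [j1 j2]; rewrite xpair_eqE /= expnS.
by case: (i1 == j1); case: (i2 == j2); rewrite /= ?muln0 ?muln1.
Qed.

(** If two distinct labels gave one matrix, orthogonality would make the trace of the identity
    vanish. *)
Lemma pauli_inj n : injective (@pauli n).
Proof.
move=> i j e; have := pauli_ortho i j; rewrite e pauli_sqr mxtrace1.
case: eqP => // _ /eqP; rewrite muln0 pnatr_eq0 qdimE expn_eq0 //.
Qed.

(** The swap of two [n]-qubit registers is the tensor product of the qubit swaps, so the identity
    follows by splitting off the first qubit from each index. *)
Lemma pauli_complete n (i j k l : 'I_(qdim n)) :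
  \sum_(p : pidx n) pauli p i j * pauli p k l =
  (2 ^ n * ((i == l) && (j == k)))%:R.
Proof.
elim: n i j k l => [|n IH] i j k l.
  rewrite (big_pred1 tt) => [|[] //].
  by rewrite !ord1 !mxE /= mulr1.
case: (mxtens_indexP i) => i0 i1; case: (mxtens_indexP j) => j0 j1.
case: (mxtens_indexP k) => k0 k1; case: (mxtens_indexP l) => l0 l1.
rewrite !(can_eq (@mxtens_indexK 2 (qdim n))) !xpair_eqE.
transitivity (\sum_p (pauli1 p i0 j0 * pauli1 p k0 l0 * \sum_(q : pidx n)
   pauli q i1 j1 * pauli q k1 l1)).
  under [RHS]eq_bigr do rewrite big_distrr; rewrite pair_bigA.
  apply: eq_bigr => -[p q] _ /=.
  by rewrite !tensmxE mulrACA.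
rewrite -big_distrl /= pauli1_complete IH -natrM; congr (_%:R).
rewrite expnS; move: (i0 == l0) (i1 == l1) (j0 == k0) (j1 == k1).
by move=> [] [] [] []; rewrite /= ?muln0 ?muln1.
Qed.

Lemma paulisE n : paulis n = range (@pauli n) :> set 'M[C]_(qdim n).
Proof.
elim: n => [|n IH]; apply/seteqP; split => A /=.
- by move=> ->; exists tt.
- by move=> [i _ <-].
- move=> [P hP [Q]]; rewrite IH => -[i _ <-] <-.
  have [p ->] : exists p, P = pauli1 p.
    case: hP => [[[]|]|] ->; [exists (false, false)|exists (true, false)|
      exists (true, true)|exists (false, true)]; by [].
  by exists (p, i).
- move=> [[p i] _ <-]; exists (pauli1 p); last first.
    by exists (pauli i); rewrite ?IH //; exists i.
  by case: p => [[] []] /=;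
    [left; right|left; left; right|right|left; left; left].
Qed.

Lemma paulis_pauli n (i : pidx n) : paulis n (pauli i).
Proof. by rewrite paulisE; exists i. Qed.

(** The depolarizing identity: contract [pauli_complete] with the entries of [rho]. Only the
    diagonal entries survive. *)
Lemma sum_pauli_conj n (rho : 'M[C]_(qdim n)) :
  \sum_(p : pidx n) pauli p *m rho *m pauli p = (2 ^+ n * \tr rho)%:M.
Proof.
apply/matrixP => i j; rewrite summxE.
transitivity (\sum_(p : pidx n) \sum_k \sum_l
    rho l k * (pauli p i l * pauli p k j)).
  apply: eq_bigr => p _; rewrite mxE; apply: eq_bigr => k _.
  by rewrite mxE mulr_suml; apply: eq_bigr => l _; rewrite mulrAC mulrC.
rewrite exchange_big /=.
transitivity (\sum_k 2 ^+ n * (rho k k *+ (i == j))).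
  apply: eq_bigr => k _; rewrite exchange_big /= (bigD1 k) //= [X in _ + X]big1.
    rewrite -mulr_sumr pauli_complete eqxx andbT addr0 natrM natrX mulrCA.
    by rewrite mulr_natr.
  move=> l /negbTE nlk; rewrite -mulr_sumr pauli_complete nlk andbF muln0.
  by rewrite mulr0.
by rewrite -mulr_sumr mxE -mulrnAr sumrMnl.
Qed.

End Paulis.

(** * Clifford unitaries up to phase *)

Lemma finite_self_inj (T : choiceType) (A : set T) (h : T -> T) :
  finite_set A -> set_inj A h -> h @` A `<=` A -> h @` A = A.
Proof.
move=> fin hinj sub; apply: fset_set_inj => //; first exact: finite_image.
(* Pigeonhole: the image is a subset of [A] with as many elements as [A]. *)
apply/eqP; rewrite eqEfcard; apply/andP; split.
  by rewrite -fset_set_sub //; exact: finite_image.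
rewrite fset_set_image // card_in_imfset //= => x y.
by rewrite !in_fset_set // => xA yA; apply: hinj.
Qed.

Section Clifford.
Variable C : numClosedFieldType.

Lemma unitarymx_adj n (U : 'M[C]_n) : U \is unitarymx ->
  (U *m U^t* = 1%:M) * (U^t* *m U = 1%:M).
Proof. by move=> /unitarymxP e; split=> //; apply: mulmx1C. Qed.

Lemma adjM m n p (A : 'M[C]_(m, n)) (B : 'M[C]_(n, p)) :
  (A *m B)^t* = B^t* *m A^t*.
Proof. by rewrite trmx_mul map_mxM. Qed.

Lemma qdim_gt0 n : (0 < qdim n)%N.
Proof. by rewrite qdimE expn_gt0. Qed.

Lemma scalar_inj_qdim n : injective (fun z : C => z%:M : 'M_(qdim n)).
Proof.
move=> y z /matrixP /(_ (Ordinal (qdim_gt0 n)) (Ordinal (qdim_gt0 n))).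
by rewrite !mxE eqxx !mulr1n.
Qed.

(** Each term P W P of the depolarizing sum equals W, so a nonzero multiple of W is scalar. *)
Lemma pauli_commutant n (W : 'M[C]_(qdim n)) :
  (forall i : pidx n, W *m pauli C i = pauli C i *m W) -> exists z, W = z%:M.
Proof.
move=> cW; have := sum_pauli_conj W.
under eq_bigr do rewrite -cW -mulmxA pauli_sqr mulmx1.
rewrite sumr_const => e; exists ((#|pidx n|%:R)^-1 * (2 ^+ n * \tr W)).
have c0 : (#|pidx n|%:R : C) != 0.
  rewrite pnatr_eq0 -lt0n; apply/card_gt0P.
  by elim: n {W cW e} => [|n [i _]]; [exists tt | exists ((true, true), i)].
by rewrite -scale_scalar_mx -e -scaler_nat scalerA mulVf ?scale1r.
Qed.

(** A conjugate of a Pauli still squares to the identity, which forces [z ^+ 2 = 1]. *)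
Lemma conj_pauli_sign n (U : 'M[C]_(qdim n)) (i k : pidx n) z :
  U \is unitarymx -> U *m pauli C i *m U^t* = z *: pauli C k -> z = 1 \/ z = -1.
Proof.
move=> /unitarymx_adj uU e; apply/pred2P; rewrite -sqrf_eq1; apply/eqP.
apply: (@scalar_inj_qdim n); rewrite -(scalemx1 _ (z ^+ 2)) -(pauli_sqr C k).
have <- : (z *: pauli C k) *m (z *: pauli C k) =
    z ^+ 2 *: (pauli C k *m pauli C k).
  by rewrite -scalemxAl -scalemxAr scalerA.
rewrite -e !mulmxA -(mulmxA _ (U^t*) U) uU mulmx1.
by rewrite -(mulmxA U) pauli_sqr mulmx1 uU pauli_sqr.
Qed.

Lemma phase_equivP d (A B : 'M[C]_d) :
  reflect (exists2 z : C, `|z| = 1 & A = z *: B) (phase_equiv A B).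
Proof. exact: asboolP. Qed.

Lemma clifford_pauli n (U : 'M[C]_(qdim n)) (i : pidx n) : clifford_mx n U ->
  exists k (b : bool), U *m pauli C i *m U^t* = (-1) ^+ b *: pauli C k.
Proof.
move=> [uU /(_ _ (paulis_pauli C i))[Q]]; rewrite paulisE => -[k _ <-].
move=> /phase_equivP[z _ e]; exists k.
by rewrite e; have [->|->] := conj_pauli_sign uU e; [exists false|exists true].
Qed.

(** [V^t* *m U] commutes with every Pauli, hence is a scalar; unitarity gives it modulus 1. *)
Lemma same_chan_pauli n (U V : 'M[C]_(qdim n)) :
  U \is unitarymx -> V \is unitarymx ->
  (forall i : pidx n, chan U (pauli C i) = chan V (pauli C i)) ->
  phase_equiv U V.
Proof.
move=> uU uV e; have [eU eU'] := unitarymx_adj uU.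
have [eV eV'] := unitarymx_adj uV.
have [|z ez] := @pauli_commutant n (V^t* *m U).
  move=> i; have := e i; rewrite /chan.
  move=> /(congr1 (fun A => V^t* *m A *m U)); rewrite !mulmxA eV' mul1mx.
  by rewrite -!mulmxA eU' mulmx1.
have eUV : U = z *: V by rewrite -(mul1mx U) -eV -mulmxA ez mul_mx_scalar.
apply/phase_equivP; exists z => //.
have : (z * z^*)%:M = 1%:M :> 'M[C]_(qdim n).
  by rewrite -eU eUV Defs.adjZ -scalemxAl -scalemxAr scalerA eV scalemx1.
move=> /(@scalar_inj_qdim n); rewrite -normCK => /eqP.
by rewrite sqrp_eq1 // => /eqP.
Qed.

Local Notation mod_phase d := {eq_quot (@phase_equiv C d)} (only parsing).

Lemma phase_equiv_repr d (U : 'M[C]_d) :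
  phase_equiv (repr (\pi_(mod_phase d) U)) U.
Proof. by apply/eqmodP; rewrite reprK. Qed.

(** * The symmetric Clifford group and the invariance of its twirl *)

Section SymGroup.
Variables (n : nat) (S : set 'M[C]_(qdim n)).

(** Makes membership a property of phase classes, so that the [repr] of a class in the group is
    again a symmetric Clifford matrix. *)
Lemma sym_clifford_mx_phase U V : phase_equiv U V ->
  sym_clifford_mx S U -> sym_clifford_mx S V.
Proof.
move=> eUV [[uU cU] sU]; have /phase_equivP [z z1 eV] : phase_equiv V U.
  by rewrite phase_equiv_sym.
have e P : V *m P *m V^t* = U *m P *m U^t* :=
  congr1 (@^~ P) (esym (chan_phase eUV)).
split; last first.
  by move=> P /sU cUP; rewrite /comm_mx eV -scalemxAl cUP scalemxAr.
split; last by move=> P /cU[Q ? ?]; exists Q; rewrite // e.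
by apply/unitarymxP; rewrite -{1}[V]mulmx1 e mulmx1; case/unitarymx_adj: uU.
Qed.

Lemma sym_clifford_mxM U V : sym_clifford_mx S U -> sym_clifford_mx S V ->
  sym_clifford_mx S (U *m V).
Proof.
move=> [[uU cU] sU] [[uV cV] sV]; split; last first.
  move=> P SP; rewrite /comm_mx -mulmxA (sV _ SP) mulmxA (sU _ SP).
  by rewrite mulmxA.
split; first exact: mul_unitarymx.
move=> P /cV[Q /cU[Q' Q'P eQ'] /phase_equivP[z z1 eQ]]; exists Q' => //.
apply: phase_equiv_trans eQ'; apply/phase_equivP; exists z => //.
rewrite adjM -mulmxA !mulmxA -(mulmxA U) -(mulmxA U) eQ.
by rewrite -scalemxAr -scalemxAl.
Qed.

Lemma sym_clifford_mx1 : sym_clifford_mx S 1%:M.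
Proof.
split; last by move=> P _; rewrite /comm_mx mul1mx mulmx1.
have e : (1%:M : 'M[C]_(qdim n))^t* = 1%:M by rewrite trmx1 map_mx1.
split; first by apply/unitarymxP; rewrite e mulmx1.
by move=> P ?; exists P; rewrite // e mul1mx mulmx1 phase_equiv_refl.
Qed.

Lemma sym_clifford_repr D : sym_clifford S D -> sym_clifford_mx S (repr D).
Proof.
move=> [U SU <-]; apply: sym_clifford_mx_phase SU.
by rewrite phase_equiv_sym phase_equiv_repr.
Qed.

Lemma finite_sym_clifford : finite_set (sym_clifford S).
Proof.
have code D : exists g : {ffun pidx n -> pidx n * bool}, sym_clifford S D ->
    forall i, chan (repr D) (pauli C i) = (-1) ^+ (g i).2 *: pauli C (g i).1.
  (* The code of a class is its signed action on Pauli labels; a class outside the group gets an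
     arbitrary code. *)
  have [DS|] := pselect (sym_clifford S D); last first.
    by exists [ffun i => (i, false)].
  have [cD _] := sym_clifford_repr DS.
  have [g gP] := choice (fun i => clifford_pauli i cD).
  have [h hP] := choice gP.
  by exists [ffun i => (g i, h i)] => _ i; rewrite ffunE /= -hP.
have [f fP] := choice code.
have /Pinj[g eqg] : {in sym_clifford S &, injective f}.
  move=> D E; rewrite !inE => DS ES eDE.
  have [[uD _] _] := sym_clifford_repr DS.
  have [[uE _] _] := sym_clifford_repr ES.
  rewrite -(reprK D) -(reprK E); apply/eqmodP; apply: same_chan_pauli => // i.
  by rewrite !fP // eDE.
rewrite -(eq_finite_set (card_image g)); exact: finite_finset.
Qed.

(** Left translation by [V] is injective because [V] is invertible; finiteness of the group then
    makes it surjective. *)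
Lemma sym_clifford_mulr V : sym_clifford_mx S V ->
  (fun D => \pi_(mod_phase (qdim n)) (V *m repr D)) @` sym_clifford S =
    sym_clifford S /\
  set_inj (sym_clifford S) (fun D => \pi_(mod_phase (qdim n)) (V *m repr D)).
Proof.
move=> SV; set h := (X in X @` _).
have hinj : set_inj (sym_clifford S) h.
  move=> D E _ _ /eqmodP /phase_equivP[z z1 e].
  rewrite -(reprK D) -(reprK E); apply/eqmodP/phase_equivP; exists z => //.
  have [[/unitarymx_adj[_ uV] _] _] := SV.
  by rewrite -(mul1mx (repr D)) -uV -mulmxA e -scalemxAr mulmxA uV mul1mx.
split=> //; have fin := finite_sym_clifford.
have sub : h @` sym_clifford S `<=` sym_clifford S.
  move=> _ [D SD <-]; exists (V *m repr D) => //.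
  exact/sym_clifford_mxM/sym_clifford_repr.
exact: finite_self_inj.
Qed.

Lemma sym_twirlE E rho : sym_twirl S E rho =
  (#|` fset_set (sym_clifford S)|%:R)^-1 *:
    \sum_(D <- fset_set (sym_clifford S))
      adj_chan (repr D) (E (chan (repr D) rho)).
Proof.
rewrite /sym_twirl /average fsbig_finite; last exact: finite_sym_clifford.
by rewrite /= !fctE fct_sumE.
Qed.

(** Reindex the average along D -> V D; the choice of [repr] in the class of V D does not affect the
    channels. *)
Lemma sym_twirl_conj V E : sym_clifford_mx S V ->
  sym_twirl S (adj_chan V \o E \o chan V) = sym_twirl S E.
Proof.
move=> SV; have [him hinj] := sym_clifford_mulr SV.
rewrite /sym_twirl /average -[in RHS]him (fsbig_image _ _ _ hinj) him.
congr (_ *: _); apply: eq_fsbigr => D _; apply/funext => rho /=.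
rewrite (adj_chan_phase (phase_equiv_repr _)) (chan_phase (phase_equiv_repr _)).
by rewrite /chan /adj_chan !adjM !mulmxA.
Qed.

(** Conjugating the channel of V P V^* by the channel of V gives back the channel of P, and the
    twirl does not see this conjugation. *)
Lemma sym_twirl_chan V P Q : sym_clifford_mx S V ->
  phase_equiv (V *m P *m V^t*) Q -> sym_twirl S (chan P) = sym_twirl S (chan Q).
Proof.
move=> SV /chan_phase <-; rewrite -[RHS](sym_twirl_conj _ SV); congr sym_twirl.
apply/funext => rho; rewrite /= /adj_chan /chan !adjM trmxCK !mulmxA.
have [[/unitarymx_adj uV _] _] := SV.
rewrite uV mul1mx -!mulmxA uV mulmx1 !mulmxA.
by rewrite -!(mulmxA _ (V^t*) V) !uV !mulmx1.
Qed.

Lemma sym_twirl_fixed E :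
  (forall D rho, sym_clifford_mx S D -> adj_chan D (E (chan D rho)) = E rho) ->
  sym_twirl S E = E.
Proof.
move=> fE; apply/funext => rho; rewrite sym_twirlE.
rewrite (eq_big_seq (fun=> E rho)) => [|D]; last first.
  rewrite in_fset_set ?inE; last exact: finite_sym_clifford.
  by move=> /sym_clifford_repr /fE ->.
rewrite big_const_seq count_predT iter_addr_0 -scaler_nat.
rewrite scalerA mulVf ?scale1r //.
(* The normalizing cardinal is nonzero because the group contains the class of the identity. *)
rewrite pnatr_eq0 cardfs_eq0; apply/negP => /eqP e.
have : \pi_(mod_phase (qdim n)) 1%:M \in fset_set (sym_clifford S).
  rewrite in_fset_set ?inE; last exact: finite_sym_clifford.
  by exists 1%:M => //; exact: sym_clifford_mx1.
by rewrite e inE.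
Qed.

Lemma sym_twirl_average (I : finType) (E : I -> superop C (qdim n)) c :
  sym_twirl S (c *: \sum_i E i) = c *: \sum_i sym_twirl S (E i).
Proof.
apply/funext => rho; rewrite sym_twirlE !fctE !fct_sumE.
under [in RHS]eq_bigr do rewrite sym_twirlE.
rewrite -scaler_sumr scalerA [c * _]mulrC -scalerA; congr (_ *: _).
rewrite exchange_big scaler_sumr; apply: eq_bigr => D _.
rewrite /adj_chan -scalemxAr -scalemxAl; congr (_ *: _).
by rewrite mulmx_sumr mulmx_suml.
Qed.

End SymGroup.
End Clifford.

(** * Averages over sets enumerated by a finite type *)

Lemma fsbig_range (I : finType) (T : choiceType) (V : nmodType) (h : I -> T)
    (F : T -> V) : injective h -> \sum_(t \in range h) F t = \sum_i F (h i).
Proof.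
move=> hinj; rewrite (fsbig_image _ _ _ (in2W hinj)).
rewrite [RHS]fsbig_seq ?index_enum_uniq //; congr (\sum_(i \in _) _).
by apply/seteqP; split=> i //= _; rewrite mem_index_enum.
Qed.

Lemma average_range (C : numClosedFieldType) (I : finType) (T : choiceType)
    (V : lmodType C) (h : I -> T) (F : T -> V) : injective h ->
  average (range h) F = #|I|%:R^-1 *: \sum_i F (h i).
Proof.
move=> hinj; rewrite /average fsbig_range //; congr (_%:R^-1 *: _).
(* Summing the constant 1 computes the cardinal of the range. *)
have := fsbig_range (fun=> 1%N) hinj.
rewrite fsbig_finite; last exact: finite_image.
by rewrite sum1_size sum1_card.
Qed.

(** * Pauli rotations as Clifford gates *)

Section SymmetricTwirl.
Variable C : numClosedFieldType.

(* The Clifford gate exp(i pi/4 G), with a different global phase that avoids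
   the square root of 2. *)
Definition rot d (G : 'M[C]_d) : 'M[C]_d := ((1 + 'i) / 2) *: (1%:M + 'i *: G).

Lemma rot_adj d (G : 'M[C]_d) : G^t* = G ->
  (rot G)^t* = ((1 - 'i) / 2) *: (1%:M - 'i *: G).
Proof.
move=> hG; rewrite Defs.adjZ linearD /= map_mxD trmx1 map_mx1 Defs.adjZ hG.
rewrite conjCi.
by rewrite scaleNr rmorphM fmorphV rmorphD rmorph1 rmorph_nat /= conjCi.
Qed.

Lemma rot_coef : (1 + 'i) / 2 * ((1 - 'i) / 2) = 2^-1 :> C.
Proof.
have /eqP : 'i ^+ 2 = -1 :> C := sqrCi C.
have n2 : 2 != 0 :> C by rewrite pnatr_eq0.
move=> /eqP ii; transitivity ((1 - 'i ^+ 2) / 4 : C); first by field.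
by rewrite ii; field.
Qed.

(** Two values of [x] matter: -1 yields unitarity of [rot G], and 1 yields the square used to
    conjugate an anticommuting matrix. *)
Lemma mulmx_rot d (G : 'M[C]_d) x : G *m G = 1%:M ->
  (1%:M + 'i *: G) *m (1%:M + (x * 'i) *: G) =
  (1 - x) *: 1%:M + ((1 + x) * 'i) *: G.
Proof.
move=> GG; rewrite mulmxDl mul1mx mulmxDr mulmx1.
rewrite -scalemxAl -scalemxAr GG scalerA.
rewrite mulrCA -expr2 sqrCi mulrN1 ['i *: G + _]addrC addrACA.
rewrite -{1}[1%:M]scale1r -!scalerDl mulrDl mul1r; congr (_ + _ *: _).
by rewrite addrC.
Qed.

Lemma rot_unitary d (G : 'M[C]_d) : G^t* = G -> G *m G = 1%:M ->
  rot G \is unitarymx.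
Proof.
move=> hG GG; apply/unitarymxP; rewrite rot_adj // -scalemxAl -scalemxAr.
rewrite scalerA rot_coef -scaleNr -[- 'i]mulN1r.
rewrite mulmx_rot // subrr mul0r scale0r addr0.
by rewrite opprK scalerA mulVf ?scale1r // pnatr_eq0.
Qed.

Lemma rot_comm d (G P : 'M[C]_d) : comm_mx P G -> comm_mx P (rot G).
Proof.
move=> c; rewrite /comm_mx /rot -scalemxAl -scalemxAr mulmxDl mulmxDr.
by rewrite -scalemxAl -scalemxAr c mul1mx mulmx1.
Qed.

Lemma rot_conj_comm d (G P : 'M[C]_d) : G^t* = G -> G *m G = 1%:M ->
  comm_mx P G -> rot G *m P *m (rot G)^t* = P.
Proof.
move=> hG GG /rot_comm <-; rewrite -mulmxA.
by have /unitarymxP -> := rot_unitary hG GG; rewrite mulmx1.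
Qed.

Lemma rot_conj_anticomm d (G P : 'M[C]_d) : G^t* = G -> G *m G = 1%:M ->
  P *m G = - (G *m P) -> rot G *m P *m (rot G)^t* = 'i *: (G *m P).
Proof.
move=> hG GG aP; rewrite rot_adj // -scalemxAl -scalemxAr -scalemxAl scalerA.
rewrite [_ / 2 * _]mulrC rot_coef.
(* Moving P to the right past the last factor flips the sign of G, leaving the square of the first
   factor. *)
have -> : (1%:M + 'i *: G) *m P *m (1%:M - 'i *: G) =
    (1%:M + 'i *: G) *m (1%:M + (1 * 'i) *: G) *m P.
  rewrite -!mulmxA; congr (_ *m _).
  by rewrite mulmxBr mulmxDl mulmx1 mul1mx mul1r -scalemxAr -scalemxAl
    aP scalerN opprK.
rewrite mulmx_rot // subrr scale0r add0r -scalemxAl scalerA mulrA.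
by rewrite mulVf ?mul1r // pnatr_eq0.
Qed.

Lemma pauli_one n : exists i : pidx n, pauli C i = 1%:M.
Proof.
elim: n => [|n [i e]]; first by exists tt.
by exists ((false, false), i); rewrite /= e /pauliI tens1mx1.
Qed.

(** Taking adjoints reverses the product and conjugates its phase z, so the two orders differ by
    [z ^+ 2]. This is also the phase acquired by one Pauli conjugated by the other, hence a sign. *)
Lemma pauli_comm n (i j : pidx n) :
  pauli C i *m pauli C j = pauli C j *m pauli C i \/
  pauli C i *m pauli C j = - (pauli C j *m pauli C i).
Proof.
have [k [z z1 e]] := pauli_mul C i j.
have e' : pauli C j *m pauli C i = z^* *: pauli C k.
  by rewrite -[LHS]trmxCK adjM !pauli_adj e Defs.adjZ pauli_adj.
have ez : pauli C i *m pauli C j = z ^+ 2 *: (pauli C j *m pauli C i).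
  by rewrite e e' scalerA expr2 -mulrA phase_conj ?mulr1.
have uP : pauli C i \is unitarymx.
  by apply/unitarymxP; rewrite pauli_adj pauli_sqr.
have [] := conj_pauli_sign (i := j) (k := j) (z := z ^+ 2) uP.
- by rewrite pauli_adj ez -scalemxAl -mulmxA pauli_sqr mulmx1.
- by move=> z2; left; rewrite ez z2 scale1r.
- by move=> z2; right; rewrite ez z2 scaleN1r.
Qed.

Lemma rot_clifford n (g : pidx n) : clifford_mx n (rot (pauli C g)).
Proof.
have [hG GG] := (pauli_adj C g, pauli_sqr C g).
split; first exact: rot_unitary.
move=> P; rewrite paulisE => -[i _ <-].
have [c|c] := pauli_comm i g.
  by rewrite rot_conj_comm //; exists (pauli C i); rewrite ?phase_equiv_refl.
have [k [z z1 e]] := pauli_mul C g i.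
exists (pauli C k); first by exists k.
rewrite rot_conj_anticomm // e; apply/phase_equivP; exists ('i * z).
  by rewrite normrM normCi z1 mulr1.
by rewrite scalerA.
Qed.

Lemma pauliZ_conj p :
  pauliZ *m pauli1 C p *m pauliZ = (-1) ^+ p.1 *: pauli1 C p.
Proof.
by case: p => [[] []]; rewrite /= /pauliI ?mx2_1 ?mx2_mul mx2_scale;
  congr mx2; ring.
Qed.

(** * Twirling Pauli channels on the first qubit *)

Section FirstQubit.
Variable n : nat.
Let Zf : 'M[C]_(qdim n.+1) := on_first n pauliZ.

Lemma on_firstZ_conj (p : pidx n.+1) :
  Zf *m pauli C p *m Zf = (-1) ^+ p.1.1 *: pauli C p.
Proof.
case: p => p i; rewrite /= !tensmx_mul.
by rewrite mul1mx mulmx1 pauliZ_conj tensmxZl.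
Qed.

Lemma on_firstZ_sqr : Zf *m Zf = 1%:M.
Proof. by rewrite tensmx_mul mul1mx (pauli1_sqr C (false, true)) tens1mx1. Qed.

(* A Pauli P commutes or anticommutes with Zf, so P - Zf P Zf is 0 or 2 P: this
   sieves X and Y on the first qubit out of the full Pauli sum. *)
Lemma sum_XY_conj (rho : 'M[C]_(qdim n.+1)) :
  \sum_(q : bool * pidx n) chan (pauli1 C (true, q.1) *t pauli C q.2) rho =
  2 ^+ n *: ((\tr rho)%:M - \tr (Zf *m rho) *: Zf).
Proof.
have n2 : 2 != 0 :> C by rewrite pnatr_eq0.
(* The factor 2 turns [2 ^+ n] into the constant of the depolarizing identity on [n.+1] qubits,
   applied below to [rho] and to [Zf *m rho]. *)
apply: (scalerI n2); rewrite !scalerA -exprS.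
transitivity (\sum_(p : pidx n.+1)
    (pauli C p *m rho *m pauli C p -
     Zf *m (pauli C p *m (Zf *m rho) *m pauli C p))).
  have e p : pauli C p *m rho *m pauli C p -
      Zf *m (pauli C p *m (Zf *m rho) *m pauli C p) =
      if p.1.1 then 2 *: chan (pauli C p) rho else 0.
    rewrite /chan pauli_adj !mulmxA on_firstZ_conj -!scalemxAl.
    case: p.1.1; last by rewrite scale1r subrr.
    by rewrite expr1 scaleN1r opprK -mulr2n -scaler_nat.
  rewrite (eq_bigr _ (fun p _ => e p)) -big_mkcond scaler_sumr /=.
  rewrite (reindex (fun q : bool * pidx n =>
    ((true, q.1), q.2) : pidx n.+1)) /=.
    by apply: eq_bigl.
  exists (fun p : pidx n.+1 => (p.1.2, p.2)); first by case.
  by move=> [[[] b] i].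
rewrite sumrB -mulmx_sumr !sum_pauli_conj mul_mx_scalar scalerBr scalerA.
by rewrite scale_scalar_mx.
Qed.

Lemma sym_clifford_on_firstZ U : sym_clifford_mx (QU n) U -> comm_mx U Zf.
Proof. by move=> [_]; apply; exists pauliZ => //; right. Qed.

(** The condition on [g] says that its Pauli commutes with [Zf]; the rotation inherits this. *)
Lemma rot_sym (g : pidx n.+1) : ~~ g.1.1 ->
  sym_clifford_mx (QU n) (rot (pauli C g)).
Proof.
move=> gZ; split; first exact: rot_clifford.
move=> _ [P [->|->] <-]; apply/comm_mx_sym/rot_comm.
  by rewrite /comm_mx /on_first /pauliI tens1mx1 mul1mx mulmx1.
have := on_firstZ_conj g; rewrite (negbTE gZ) scale1r => e.
by rewrite /comm_mx -[in RHS]e -[RHS]mulmxA -mulmxA on_firstZ_sqr mulmx1.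
Qed.

Lemma sym_twirl_flip b (j : pidx n) :
  sym_twirl (QU n) (chan (on_first n (pauli1 C (true, b)))) =
  sym_twirl (QU n) (chan (pauli1 C (true, ~~ b) *t pauli C j)).
Proof.
have [o eo] := pauli_one n.
(* [g] labels Z (x) Q, which anticommutes with X (x) I and Y (x) I; multiplying by it exchanges X
   and Y up to phase and puts Q on the other qubits. *)
pose g : pidx n.+1 := ((false, true), j).
pose x : pidx n.+1 := ((true, b), o).
have -> : on_first n (pauli1 C (true, b)) = pauli C x by rewrite /= eo.
apply: (@sym_twirl_chan _ _ _ (rot (pauli C g))); first exact: rot_sym.
have aP : pauli1 C (true, b) *m pauliZ = - (pauliZ *m pauli1 C (true, b)).
  rewrite -[LHS]mul1mx -(pauli1_sqr C (false, true)) mulmxA.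
  by rewrite -(mulmxA _ _ (pauli1 C (true, b))) -mulmxA pauliZ_conj
    scaleN1r mulmxN.
rewrite rot_conj_anticomm ?pauli_adj ?pauli_sqr //; last first.
  by rewrite /= !tensmx_mul eo mulmx1 mul1mx aP -scaleN1r tensmxZl scaleN1r.
have [z z1 e] := pauli1_mul C (false, true) (true, b).
apply/phase_equivP; exists ('i * z); first by rewrite normrM normCi z1 mulr1.
rewrite /= tensmx_mul eo mulmx1.
by rewrite [X in X *t _]e tensmxZl scalerA.
Qed.

Lemma sym_twirl_XY b (q : bool * pidx n) :
  sym_twirl (QU n) (chan (pauli1 C (true, q.1) *t pauli C q.2)) =
  sym_twirl (QU n) (chan (on_first n (pauli1 C (true, b)))).
Proof.
have [o eo] := pauli_one n.
(* With the identity label [o] on the other qubits, the flip exchanges X (x) I and Y (x) I. *)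
have flip c : sym_twirl (QU n) (chan (on_first n (pauli1 C (true, c)))) =
    sym_twirl (QU n) (chan (on_first n (pauli1 C (true, ~~ c)))).
  by rewrite (sym_twirl_flip c o) eo.
have any c : sym_twirl (QU n) (chan (on_first n (pauli1 C (true, c)))) =
    sym_twirl (QU n) (chan (on_first n (pauli1 C (true, b)))).
  by have [->//|/eqP/negPf] := c =P b; case: c b => [] [] // _; rewrite flip.
by case: q => c j; rewrite -[c]negbK -sym_twirl_flip any.
Qed.

(** By [sum_XY_conj], [M] sees its argument only through its traces against the identity and [Zf].
    Conjugation by a unitary commuting with [Zf] preserves both traces and fixes the output. *)
Lemma sym_twirl_sum_XY (c : C) :
  let M := c *: \sum_(q : bool * pidx n)
    chan (pauli1 C (true, q.1) *t pauli C q.2) in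
  sym_twirl (QU n) M = M.
Proof.
move=> M; apply: sym_twirl_fixed => D rho SD.
have [[/unitarymx_adj uD _] _] := SD.
have cD := sym_clifford_on_firstZ SD.
have tD A : \tr (D *m A *m D^t*) = \tr A.
  by rewrite mxtrace_mulC mulmxA uD mul1mx.
rewrite /M !fctE !fct_sumE !sum_XY_conj /adj_chan /chan.
rewrite -!scalemxAr -!scalemxAl; do 2 congr (_ *: _).
rewrite tD !mulmxA -cD -(mulmxA D Zf) tD mulmxBr mulmxBl.
rewrite mul_mx_scalar -scalemxAl uD scalemx1 -scalemxAr -scalemxAl.
by rewrite -mulmxA -cD mulmxA uD mul1mx.
Qed.

Lemma pauli_chanE (p : pidx n.+1) : pauli_chan (pauli C p) = chan (pauli C p).
Proof. by apply/funext => rho; rewrite /chan pauli_adj. Qed.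

Lemma average_XY :
  average ([set pauliX; pauliY] `*` paulis n)
    (fun Q => pauli_chan (Q.1 *t Q.2) : superop C (qdim n.+1)) =
  #|{: bool * pidx n}|%:R^-1 *:
    \sum_(q : bool * pidx n) chan (pauli1 C (true, q.1) *t pauli C q.2).
Proof.
pose h (q : bool * pidx n) := (pauli1 C (true, q.1), pauli C q.2).
have hinj : injective h.
  move=> [b i] [c j] [e /pauli_inj ->]; congr (_, _).
  (* Tensoring with the 1 x 1 identity reduces the first factor to [pauli_inj] on one qubit. *)
  have : pauli C ((true, b, tt) : pidx 1) = pauli C ((true, c, tt) : pidx 1).
    by rewrite /= e.
  by move=> /pauli_inj [].
have -> : [set pauliX; pauliY] `*` paulis n = range h.
  rewrite paulisE; apply/seteqP; split.
    move=> [P Q] [/= [->|->] [i _ <-]]; first by exists (false, i).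
    by exists (true, i).
  move=> _ [[b i] _ <-]; split=> /=; last by exists i.
  by case: b; [right|left].
rewrite average_range //; congr (_ *: _); apply: eq_bigr => q _.
exact: (pauli_chanE ((true, q.1), q.2)).
Qed.

Lemma sym_twirl_on_first_XY b :
  sym_twirl (QU n) (pauli_chan (on_first n (pauli1 C (true, b)))) =
  average ([set pauliX; pauliY] `*` paulis n)
    (fun Q => pauli_chan (Q.1 *t Q.2) : superop C (qdim n.+1)).
Proof.
have [o eo] := pauli_one n.
have -> : pauli_chan (on_first n (pauli1 C (true, b))) =
    chan (on_first n (pauli1 C (true, b))).
  by have := pauli_chanE ((true, b), o); rewrite /= eo.
(* The mean is replaced by its own twirl, which linearity turns into a mean of equal twirls. *)
rewrite average_XY -sym_twirl_sum_XY sym_twirl_average.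
rewrite (eq_bigr _ (fun q _ => sym_twirl_XY b q)) sumr_const.
rewrite -scaler_nat scalerA mulVf ?scale1r // pnatr_eq0 -lt0n.
by apply/card_gt0P; exists (true, o).
Qed.

(** Every D in the group commutes with [Zf], so D moves through it on both sides and cancels against
    its adjoint. *)
Lemma sym_twirl_on_firstZ : sym_twirl (QU n) (pauli_chan Zf) = pauli_chan Zf.
Proof.
apply: sym_twirl_fixed => D rho SD; have [[/unitarymx_adj uD _] _] := SD.
have cD := sym_clifford_on_firstZ SD.
rewrite /adj_chan /pauli_chan /chan !mulmxA -(mulmxA _ Zf D) -cD !mulmxA.
rewrite -(mulmxA _ Zf D) -cD !mulmxA uD mul1mx.
by rewrite -(mulmxA _ (D^t*) D) uD mulmx1.
Qed.

End FirstQubit.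

End SymmetricTwirl.

Local Open Scope complex_scope.

(* n.+1 is the number of qubits. *)
Theorem theorem1 (R : realType) (n : nat) :
  let C : numClosedFieldType := R[i] in
  (forall P : 'M[C]_2, [set pauliX; pauliY] P ->
     sym_twirl (QU n) (pauli_chan (on_first n P)) =
     average ([set pauliX; pauliY] `*` paulis n)
       (fun Q => pauli_chan (Q.1 *t Q.2) : superop C (qdim n.+1))) /\
  sym_twirl (QU n) (pauli_chan (on_first n (pauliZ : 'M[C]_2))) =
  pauli_chan (on_first n pauliZ).
Proof.
move=> C; split; last exact: sym_twirl_on_firstZ.
move=> P [->|->].
  exact: (@sym_twirl_on_first_XY C n false).
exact: (@sym_twirl_on_first_XY C n true).
Qed.
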